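(* Let $\mathbf S=(S_1,\dots,S_k)$, $k\ge1$, be a tuple of nonempty finite sets, and let $\Delta(\mathbf A)$ be a proper (nonempty) face of the polysimplex $\Delta(\mathbf S)$. The fragment $\operatorname{Fr}[\Delta(\mathbf S),\Delta(\mathbf A)]$ is a deformation of $\mathsf P(\mathbf S)$, where $\mathsf P(\mathbf S)$ is an omnitruncation of $\Delta(\mathbf S)$; that is, the normal fan of the fragment coarsens $\Psi(\mathbf S)$.
   Context: Let $\mathscr S=\bigsqcup_iS_i$. The polysimplex is $\Delta(\mathbf S)=\prod_i\Delta(S_i)\subset\mathbb R^{\mathscr S}=\bigoplus_i\mathbb R^{S_i}$, where $\Delta(S_i)=\operatorname{conv}\{e_s:s\in S_i\}$. A tuple $\mathbf A=(A_1,\dots,A_k)$ is valid if $\emptyset\ne A_i\subseteq S_i$ for all $i$; valid tuples correspond to nonempty faces $\Delta(\mathbf A)=\prod_i\Delta(A_i)$. Put $\overline{\mathbf A}=\mathscr S\setminus\bigcup_iA_i$ and $u_{\mathbf A}=\sum_{s\in\overline{\mathbf A}}e_s$. For $\mathbf A\neq\mathbf S$, the functional $u_{\mathbf A}$ is $0$ on $\Delta(\mathbf A)$ and $1$ on each vertex of $\Delta(\mathbf S)$ outside $\Delta(\mathbf A)$ adjacent to a vertex of it, and the fragment is $\operatorname{Fr}[\Delta(\mathbf S),\Delta(\mathbf A)]=\{x\in\Delta(\mathbf S) : u_{\mathbf A}\cdot x\le1\}$. Normal fans are inner normal fans: the normal cone of a nonempty face $\mathsf F$ of $\mathsf P$ is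 the set of $u$ such that $u\cdot x$ attains its minimum over $\mathsf P$ at every point of $\mathsf F$. An omnitruncation of $\Delta(\mathbf S)$ is a polytope obtained by successively truncating all nonempty proper faces of $\Delta(\mathbf S)$, smaller faces first, by half-spaces $u_{\mathbf A}\cdot x\ge\epsilon_{\mathbf A}$, each $\epsilon_{\mathbf A}>0$ being small enough that the truncating hyperplane strictly separates the (current) face from all other vertices of the current polytope. Its normal fan is the barycentric subdivision $\Psi(\mathbf S)$ of the normal fan of $\Delta(\mathbf S)$: the complete fan in $\mathbb R^{\mathscr S}$ with cones $\operatorname{Cone}(u_{\mathbf A_1},\dots,u_{\mathbf A_m})+\operatorname{Span}\{e_{S_1},\dots,e_{S_k}\}$, where $e_{S_i}=\sum_{s\in S_i}e_s$, over all (possibly empty) chains $\mathbf A_1\subsetneq\dots\subsetneq\mathbf A_m$ of valid tuples different from $\mathbf S$ (ordered componentwise by inclusion). A polytope is a deformation of $\mathsf P(\mathbf S)$ if its normal fan coarsens $\Psi(\mathbf S)$, i.e. each of its normal cones is a union of cones of $\Psi(\mathbf S)$. *)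

(* Defs.v *)
From HB Require Import structures.
From mathcomp Require Import all_boot all_order all_algebra.
From mathcomp Require Import boolp classical_sets reals.

Set Implicit Arguments.
Unset Strict Implicit.
Unset Printing Implicit Defensive.

Import Order.TTheory GRing.Theory Num.Theory.

Local Open Scope classical_set_scope.
Local Open Scope ring_scope.

(* R^T; the codomain is R^o so that MathComp's structure of R-vector space
   on finite functions applies. *)
Notation vec R T := {ffun T -> R^o}.

Section Polytopes.
Context {R : realType} {T : finType}.
Local Notation V := (vec R T).

Definition evec (t : T) : V := [ffun s => (s == t)%:R].

Definition dot (u x : V) : R := \sum_(t : T) u t * x t.

Definition conv (I : finType) (f : I -> V) : set V :=
  [set x | exists c : I -> R,
     [/\ forall i, 0 <= c i, \sum_(i : I) c i = 1 & x = \sum_(i : I) c i *: f i]].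

Definition cone (I : finType) (f : I -> V) : set V :=
  [set x | exists c : I -> R,
     (forall i, 0 <= c i) /\ x = \sum_(i : I) c i *: f i].

Definition polytope (P : set V) : Prop :=
  exists (n : nat) (f : 'I_n -> V), P = conv f.

Definition nonempty_face (P F : set V) : Prop :=
  F !=set0 /\
  exists u : V, F = [set x | P x /\ forall y, P y -> dot u x <= dot u y].

Definition normal_cone (P F : set V) : set V :=
  [set u | forall x, F x -> forall y, P y -> dot u x <= dot u y].

Definition normal_fan (P : set V) : set (set V) :=
  [set normal_cone P F | F in nonempty_face P].

Definition coarsens (N M : set (set V)) : Prop :=
  forall C, N C -> exists2 K : set (set V), K `<=` M & C = \bigcup_(D in K) D.

End Polytopes.

Section Polysimplices.
Context {R : realType} {k : nat} (S : 'I_k -> finType).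

(* The ground set: the disjoint union of the S i. *)
Definition ground : finType := {i : 'I_k & S i}.

Definition subtuple : finType := {dffun forall i : 'I_k, {set S i}}.

Definition full : subtuple := [ffun i => [set: S i]%SET].

Definition valid (A : subtuple) : Prop := forall i, A i != finset.set0.

Definition tproper (A B : subtuple) : bool :=
  [forall i, A i \subset B i] && (A != B).

Definition simplex (i : 'I_k) (B : {set S i}) : set (vec R (S i)) :=
  conv (fun s : {s : S i | s \in B} => evec (val s)).

Definition block (x : vec R ground) (i : 'I_k) : vec R (S i) :=
  [ffun s => x (Tagged S s)].

Definition polysimplex (A : subtuple) : set (vec R ground) :=
  [set x | forall i, simplex (A i) (block x i)].

Definition cotuple (A : subtuple) : {set ground} :=
  [set s : ground | tagged s \notin A (tag s)]%SET.

Definition ufun (A : subtuple) : vec R ground :=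
  \sum_(s in cotuple A) evec s.

Definition fragment (A : subtuple) : set (vec R ground) :=
  [set x | polysimplex full x /\ dot (ufun A) x <= 1].

Definition eblock (i : 'I_k) : vec R ground :=
  \sum_(s : S i) evec (Tagged S s).

Definition lineality : {vspace (vec R ground)} :=
  <<[seq eblock i | i <- enum 'I_k]>>%VS.

Definition chain_cone (m : nat) (C : 'I_m -> subtuple) : set (vec R ground) :=
  [set x + y | x in cone (fun j => ufun (C j)) & y in [set` lineality]].

(* The barycentric subdivision of the normal fan of the polysimplex. *)
Definition bary_fan : set (set (vec R ground)) :=
  [set D | exists (m : nat) (C : 'I_m -> subtuple),
     [/\ forall j, valid (C j) /\ C j != full,
         forall j j' : 'I_m, (j < j')%N -> tproper (C j) (C j')
       & D = chain_cone C]].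

(* The omnitruncations of the polysimplex all have normal fan bary_fan, so that
   being a deformation of one of them depends only on S. *)
Definition omnitruncation_deformation (P : set (vec R ground)) : Prop :=
  polytope P /\ coarsens (normal_fan P) bary_fan.

End Polysimplices.

(* Main.v *)
Require Import Defs.
From mathcomp Require Import all_boot all_order all_algebra.
From mathcomp Require Import boolp classical_sets reals.

Set Implicit Arguments.
Unset Strict Implicit.
Unset Printing Implicit Defensive.

Import Order.TTheory GRing.Theory Num.Theory.

(** By [fragmentP], the fragment is the set of [x >= 0] whose coordinates sum
    to 1 on each block [S i] and to at most 1 on the complement of [A].

    It is a polytope: it is the convex hull of the vertices of the polysimplex
    that leave [A] in at most one block ([fragment_conv]). Given a point [x] of
    the fragment, let [a i] be the mass that its block [i] puts outside [A i].
    Split the block as [(1 - a i) y_i + a i z_i], with [y_i] supported in [A i]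
    and [z_i] outside. Then [x] is the convex combination, with weights
    [1 - sum a] and [a i], of the point [y] and of the points obtained from [y]
    by replacing its block [i] with [z_i]. A point of a product of simplices is
    a convex combination of the vertices carried by its support
    ([conv_sections]), and here these vertices leave [A] in at most one block.

    For the normal fan, the key fact is that the functionals [u_C], for [C] in
    a chain of valid tuples, attain their minima over the fragment at a common
    point ([chain_minimizer]). A tuple [C] misses [A] in block [i] when [C i]
    and [A i] are disjoint; if it does so in [b] blocks, then [u_C + u_A >= b]
    and [u_A <= 1] give [u_C >= b - 1], while [u_C >= 0] in any case. The set
    of missed blocks decreases along the chain. Let the common minimizer leave
    [A] in one block that is missed as long as any block is (if there is one),
    choosing there an element of all the [C i]; in every other block choose an
    element of [A i] that belongs to every [C i] meeting [A i].

    Let now [w] lie in the normal cone [N] of a face. Up to the lineality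
    space, [w] is a positive combination of the [u_C] over the chain of its
    sublevel sets ([chain_decomposition]). As the [u_C] have a common
    minimizer, any minimizer of [w] minimizes each of these [u_C]. Hence the
    whole cone of the chain lies in [N], and [N] is the union of the cones of
    the barycentric subdivision that it contains. *)

(** * Convex combinations *)

Section Combinations.
Local Open Scope classical_set_scope.
Local Open Scope ring_scope.
Context {R : realType} {T : finType}.
Local Notation V := (vec R T).
Implicit Types (u x y : V) (a : R).

Lemma scale_vecE a x t : (a *: x) t = a * x t.
Proof. by rewrite ffunE. Qed.

Lemma sub_vecE x y t : (x - y) t = x t - y t.
Proof. by rewrite !ffunE. Qed.

Lemma comb_vecE (I : finType) (c : I -> R) (f : I -> V) t :
  (\sum_i c i *: f i) t = \sum_i c i * f i t.
Proof. by rewrite sum_ffunE; apply: eq_bigr => i _; rewrite scale_vecE. Qed.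

Lemma dotC u x : dot u x = dot x u.
Proof. by apply: eq_bigr => t _; rewrite mulrC. Qed.

Lemma dotDl u y x : dot (u + y) x = dot u x + dot y x.
Proof.
by rewrite /dot -big_split; apply: eq_bigr => t _ /=; rewrite ffunE mulrDl.
Qed.

Lemma dot_combl (I : finType) (c : I -> R) (f : I -> V) x :
  dot (\sum_i c i *: f i) x = \sum_i c i * dot (f i) x.
Proof.
under [RHS]eq_bigr do rewrite /dot mulr_sumr.
rewrite [RHS]exchange_big; apply: eq_bigr => t _ /=.
by rewrite comb_vecE mulr_suml; apply: eq_bigr => i _; rewrite mulrA.
Qed.

(** Points of zero weight need not belong to the convex hull: normalized parts
    of a point are only meaningful when they carry some mass. *)
Lemma conv_comb (I J : finType) (g : J -> V) (c : I -> R) (h : I -> V) :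
    (forall i, 0 <= c i) -> \sum_i c i = 1 ->
    (forall i, c i != 0 -> conv g (h i)) ->
  conv g (\sum_i c i *: h i).
Proof.
move=> c0 c1 gh.
have /choice[d dP] : forall i, exists d : J -> R, c i != 0 ->
    [/\ forall j, 0 <= d j, \sum_j d j = 1 & h i = \sum_j d j *: g j].
  move=> i; case: (eqVneq (c i) 0) => [_|/gh[d dP]]; last by exists d.
  by exists (fun=> 0).
exists (fun j => \sum_i c i * d i j); split.
- move=> j; apply: sumr_ge0 => i _.
  case: (eqVneq (c i) 0) => [->|/dP[d0 _ _]]; first by rewrite mul0r.
  by rewrite mulr_ge0.
- rewrite exchange_big -c1; apply: eq_bigr => i _ /=.
  case: (eqVneq (c i) 0) => [->|/dP[_ d1 _]].
    by rewrite big1 // => j _; rewrite mul0r.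
  by rewrite -mulr_sumr d1 mulr1.
- under [RHS]eq_bigr do rewrite scaler_suml.
  rewrite [RHS]exchange_big; apply: eq_bigr => i _ /=.
  case: (eqVneq (c i) 0) => [->|/dP[_ _ {1}->]].
    by rewrite scale0r big1 // => j _; rewrite mul0r scale0r.
  by rewrite scaler_sumr; apply: eq_bigr => j _; rewrite scalerA.
Qed.

Lemma conv_vertex (J : finType) (g : J -> V) j : conv g (g j).
Proof.
exists (fun i => (i == j)%:R); split => [i||].
- by rewrite ler0n.
- by rewrite (bigD1 j) //= eqxx big1 ?addr0 // => i /negPf->.
- rewrite (bigD1 j) //= eqxx scale1r big1 ?addr0 // => i /negPf->.
  by rewrite scale0r.
Qed.

Lemma polytope_conv (J : finType) (g : J -> V) : polytope (conv g).
Proof.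
exists #|J|, (g \o enum_val); apply/seteqP; split=> x [c [c0 c1 ->]].
- exists (c \o enum_val); split=> [i||] /=; first exact: c0.
    by rewrite -c1 [RHS](reindex _ (onW_bij _ (enum_val_bij J))).
  by rewrite [LHS](reindex _ (onW_bij _ (enum_val_bij J))).
- exists (c \o enum_rank); split=> [i||] /=; first exact: c0.
    by rewrite -c1 [RHS](reindex _ (onW_bij _ (enum_rank_bij J))).
  rewrite [LHS](reindex _ (onW_bij _ (enum_rank_bij J))).
  by apply: eq_bigr => j _ /=; rewrite enum_rankK.
Qed.

(** The standard simplex: [simplex] is stated with this hull of unit vectors. *)
Lemma conv_evecTP x :
  conv (fun s : {s : T | s \in [set: T]%SET} => evec (val s)) x <->
  (forall t, 0 <= x t) /\ \sum_t x t = 1.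
Proof.
split=> [[c [c0 c1 ->]]|[x0 x1]].
  split=> [t|].
    by rewrite comb_vecE sumr_ge0 // => i _; rewrite ffunE mulr_ge0.
  under eq_bigr do rewrite comb_vecE.
  rewrite exchange_big -c1; apply: eq_bigr => i _ /=.
  rewrite -mulr_sumr (bigD1 (val i)) //= ffunE eqxx big1 ?addr0 ?mulr1 // => t.
  by rewrite ffunE => /negPf->.
have inT (t : T) : t \in [set: T]%SET by rewrite inE.
pose h t : {s : T | s \in [set: T]%SET} := exist _ t (inT t).
have hb : bijective h by exists val => [//|s]; exact: val_inj.
exists (x \o val); split=> [i||]; first exact: x0.
  by rewrite (reindex _ (onW_bij _ hb)) -x1.
rewrite (reindex _ (onW_bij _ hb)); apply/ffunP => t; rewrite comb_vecE /=.
rewrite (bigD1 t) //= ffunE eqxx mulr1 big1 ?addr0 // => s /negPf st.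
by rewrite ffunE eq_sym st mulr0.
Qed.

End Combinations.

(** * Vertices of the fragment *)

Section Vertices.
Local Open Scope classical_set_scope.
Local Open Scope ring_scope.
Context {R : realType} {k : nat} (S : 'I_k -> finType).
Local Notation G := (ground S).
Local Notation V := (vec R G).
Implicit Types (A C : subtuple S) (x y z : V) (f : {ffun 'I_k -> G}).

Lemma sum_ground (F : G -> R) : \sum_t F t = \sum_i \sum_(t | tag t == i) F t.
Proof. exact: (partition_big (fun t : G => tag t) xpredT). Qed.

Lemma sum_block i (F : G -> R) :
  \sum_(s : S i) F (Tagged S s) = \sum_(t | tag t == i) F t.
Proof.
rewrite -(big_pred1_eq +%R i (fun j => \sum_(s : S j) F (Tagged S s))).
rewrite (sig_big_dep _ (fun j _ => true) (fun j s => F (Tagged S s))).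
by apply: eq_big => [t|t _]; rewrite ?andbT //; case: t.
Qed.

Lemma ufunE C t : ufun C t = (t \in cotuple C)%:R :> R.
Proof.
rewrite sum_ffunE; have [tC|tC] := boolP (t \in cotuple C).
  rewrite (bigD1 t) //= ffunE eqxx big1 ?addr0 // => s /andP[_].
  by rewrite ffunE eq_sym => /negPf->.
rewrite big1 // => s sC; rewrite ffunE; case: eqP => // ts.
by rewrite ts sC in tC.
Qed.

Lemma dot_ufun C x : dot (ufun C) x = \sum_(t in cotuple C) x t.
Proof.
rewrite [RHS]big_mkcond; apply: eq_bigr => t _; rewrite ufunE.
by case: ifP => _; rewrite ?mul1r ?mul0r.
Qed.

Lemma fragmentP A x :
  fragment A x <-> [/\ forall t, 0 <= x t,
     forall i, \sum_(t | tag t == i) x t = 1 & \sum_(t in cotuple A) x t <= 1].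
Proof.
rewrite /fragment /= dot_ufun; split=> [[xS ->]|[x0 x1 ->]].
  have {}xS i : (forall s : S i, 0 <= x (Tagged S s)) /\
      \sum_(t | tag t == i) x t = 1.
    have := xS i; rewrite /simplex ffunE => /conv_evecTP[b0 b1].
    split=> [s|]; first by have := b0 s; rewrite ffunE.
    by rewrite -sum_block -b1; apply: eq_bigr => s _; rewrite ffunE.
  split=> // [[i s]|i]; [exact: (xS i).1|exact: (xS i).2].
split=> // i; rewrite /simplex ffunE; apply/conv_evecTP; split=> [s|].
  by rewrite ffunE.
by rewrite -(x1 i) -sum_block; apply: eq_bigr => s _; rewrite ffunE.
Qed.

(** A choice of one element in each block, encoded as a map into the ground set
    whose value at [i] lies in block [i]. The codomain does not depend on [i],
    so that products of sums distribute over these maps. *)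
Definition is_section f := [forall i, tag (f i) == i].

(** The vertex of the polysimplex given by a section: the indicator function of
    its image. *)
Definition vertex f : V := [ffun t => (f (tag t) == t)%:R].

Lemma sum_vertex f (F : G -> R) : is_section f ->
  \sum_t vertex f t * F t = \sum_i F (f i).
Proof.
move=> /forallP fS; rewrite sum_ground; apply: eq_bigr => i _.
rewrite (bigD1 (f i)) ?fS //= ffunE (eqP (fS i)) eqxx mul1r.
rewrite big1 ?addr0 // => t /andP[/eqP tti tf].
by rewrite ffunE tti eq_sym (negPf tf) mul0r.
Qed.

Lemma dot_ufun_vertex C f : is_section f ->
  dot (ufun C) (vertex f) = #|[set i | f i \in cotuple C]%SET|%:R.
Proof.
move=> fS; rewrite dotC /dot sum_vertex // -sum1_card natr_sum [RHS]big_mkcond.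
by apply: eq_bigr => i _; rewrite ufunE inE; case: ifP.
Qed.

(** The sections that leave [A] in at most one block. *)
Definition fragment_vertex A f :=
  is_section f && (#|[set i | f i \in cotuple A]%SET| <= 1)%N.

Lemma fragment_vertexP A f : fragment_vertex A f -> fragment A (vertex f).
Proof.
case/andP=> fS fA; apply/fragmentP; split=> [t|i|].
- by rewrite ffunE.
- rewrite -[RHS](_ : \sum_j (j == i)%:R = 1 :> R); last first.
    by rewrite (bigD1 i) //= eqxx big1 ?addr0 // => j /negPf->.
  rewrite -[RHS](_ : \sum_j (tag (f j) == i)%:R = _ :> R); last first.
    by apply: eq_bigr => j _; rewrite (eqP (forallP fS j)).
  rewrite -(sum_vertex (fun t => (tag t == i)%:R) fS) big_mkcond.
  by apply: eq_bigr => t _; case: ifP; rewrite ?mulr1 ?mulr0.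
- by rewrite -dot_ufun dot_ufun_vertex // lern1.
Qed.

(** A point of the polysimplex is the average of the vertices [vertex f] with
    weights [\prod_i x (f i)], so it lies in any hull that contains the vertices
    carried by its support. *)
Lemma conv_sections (J : finType) (g : J -> V) x :
    (forall t, 0 <= x t) -> (forall i, \sum_(t | tag t == i) x t = 1) ->
    (forall f, is_section f -> (forall i, x (f i) != 0) -> conv g (vertex f)) ->
  conv g x.
Proof.
move=> x0 x1 gx.
(* [Y i] vanishes off block [i], so that [W] kills the maps that are not
   sections. *)
pose Y i t : R := if tag t == i then x t else 0.
pose W f := \prod_i Y i (f i).
have Y1 i : \sum_t Y i t = 1 by rewrite -big_mkcond x1.
have -> : x = \sum_f W f *: vertex f.
  apply/ffunP => t; rewrite comb_vecE; pose i := tag t.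
  (* Inserting the factor [f i == t] in the product gives the weight of [t]. *)
  pose Z j s : R := Y j s * (if j == i then (s == t)%:R else 1).
  transitivity (\sum_(f : {ffun 'I_k -> G}) \prod_j Z j (f j)).
    rewrite -bigA_distr_bigA (bigD1 i) //= [X in _ * X]big1 => [|j ji].
      rewrite mulr1 [RHS](bigD1 t) //= /Z /Y !eqxx /= mulr1 big1 ?addr0 // => s.
      by move/negPf->; rewrite mulr0.
    by rewrite -(Y1 j); apply: eq_bigr => s _; rewrite /Z (negPf ji) /= mulr1.
  apply: eq_bigr => f _; rewrite /Z big_split /= ffunE -/i; congr (_ * _).
  by rewrite -big_mkcond big_pred1_eq.
apply: conv_comb => [f||f].
- by apply: prodr_ge0 => i _; rewrite /Y; case: ifP.
- by rewrite -bigA_distr_bigA big1.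
- move/prodf_neq0=> Wf; apply: gx => [|i].
    by apply/forallP => i; have := Wf i isT; rewrite /Y; case: ifP; rewrite ?eqxx.
  by have := Wf i isT; rewrite /Y; case: ifP; rewrite ?eqxx.
Qed.

Lemma fragment_conv A : valid A ->
  fragment (R := R) A =
  conv (fun f : {f | fragment_vertex A f} => vertex (val f)).
Proof.
move=> Av; apply/seteqP; split; last first.
  move=> x [c [c0 c1 ->]].
  have fP (f : {f | fragment_vertex A f}) := fragment_vertexP (valP f).
  apply/fragmentP; split=> [t|i|].
  - rewrite comb_vecE sumr_ge0 // => f _; rewrite mulr_ge0 //.
    by have /fragmentP[] := fP f.
  - under eq_bigr do rewrite comb_vecE.
    rewrite exchange_big -c1; apply: eq_bigr => f _ /=.
    by rewrite -mulr_sumr; have /fragmentP[_ -> _] := fP f; rewrite mulr1.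
  - rewrite -dot_ufun dotC dot_combl -c1; apply: ler_sum => f _.
    rewrite ler_piMr // dotC; have /fragmentP[_ _] := fP f.
    by rewrite -dot_ufun.
move=> x /fragmentP[x0 x1 xA].
have /choice[o oP] : forall i, exists t : G, tag t = i /\ t \notin cotuple A.
  move=> i; have /set0Pn[s sA] := Av i; exists (Tagged S s).
  by rewrite inE negbK.
pose a i := \sum_(t | (tag t == i) && (t \in cotuple A)) x t.
have a0 i : 0 <= a i by apply: sumr_ge0.
have a1 i : \sum_(t | (tag t == i) && (t \notin cotuple A)) x t = 1 - a i.
  by apply/eqP; rewrite eq_sym subr_eq addrC -(x1 i) (bigID (mem (cotuple A))).
have aA : \sum_i a i <= 1.
  rewrite (le_trans _ xA) // [leRHS]big_mkcond sum_ground; apply: ler_sum => i _.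
  by rewrite -big_mkcondr.
have ale1 i : a i <= 1 by rewrite -subr_ge0 -a1 sumr_ge0.
(* When block [i] lies entirely outside [A], the vertex [o i] of [A i] serves as
   its part inside [A]: that part then has weight 0. *)
pose y : V := [ffun t => if a (tag t) == 1 then (t == o (tag t))%:R
  else if t \in cotuple A then 0 else x t / (1 - a (tag t))].
pose z : V := [ffun t => if t \in cotuple A then x t / a (tag t) else 0].
pose h i : V := if i is Some j then [ffun t => if tag t == j then z t else y t]
                else y.
pose c i := if i is Some j then a j else 1 - \sum_j a j.
have sumO (F : option 'I_k -> R) : \sum_i F i = F None + \sum_j F (Some j).
  rewrite (bigD1 None) //=; congr (_ + _).
  rewrite (reindex_omap Some id) /=; last by case.
  by apply: eq_bigl => j; rewrite eqxx.
have y0 t : 0 <= y t.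
  by rewrite ffunE; do 2?[case: ifP => // _]; rewrite divr_ge0 ?subr_ge0.
have z0 t : 0 <= z t by rewrite ffunE; case: ifP => // _; rewrite divr_ge0.
have yA t : t \in cotuple A -> y t = 0.
  rewrite ffunE => tA; rewrite tA; case: ifP => // _; case: eqP => // to.
  by have [_] := oP (tag t); rewrite -to tA.
have y1 i : \sum_(t | tag t == i) y t = 1.
  have [ai|ai] := eqVneq (a i) 1.
    rewrite (bigD1 (o i)) /=; last by rewrite (oP i).1.
    rewrite ffunE (oP i).1 ai !eqxx big1 ?addr0 // => t /andP[/eqP ti].
    by rewrite ffunE ti ai eqxx => /negPf->.
  rewrite (bigID (mem (cotuple A))) /= big1 => [|t /andP[_ /yA]//].
  rewrite add0r -[RHS](@divff _ (1 - a i)) ?subr_eq0 1?eq_sym // -{1}a1 mulr_suml.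
  apply: eq_bigr => t /andP[/eqP ti /negPf tA].
  by rewrite ffunE ti tA (negPf ai).
have z1 i : a i != 0 -> \sum_(t | tag t == i) z t = 1.
  move=> ai; rewrite -(divff ai) {1}/a mulr_suml big_mkcondr /=.
  by apply: eq_bigr => t /eqP <-; rewrite ffunE.
have xE : x = \sum_i c i *: h i.
  apply/ffunP => t; rewrite comb_vecE sumO.
  transitivity ((1 - \sum_j a j) * y t +
                \sum_j a j * (if tag t == j then z t else y t)); last first.
    by congr (_ + _); apply: eq_bigr => j _; rewrite [h _ _]ffunE.
  have -> : \sum_j a j * (if tag t == j then z t else y t) =
            a (tag t) * z t + (\sum_j a j - a (tag t)) * y t.
    rewrite (bigD1 (tag t)) //= eqxx [in RHS](bigD1 (tag t)) //= addrAC subrr.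
    rewrite add0r; congr (_ + _); rewrite mulr_suml; apply: eq_bigr => j jt.
    by rewrite eq_sym (negPf jt).
  rewrite addrCA -mulrDl addrA subrK.
  have [tA|tA] := boolP (t \in cotuple A).
    rewrite yA // mulr0 addr0 ffunE tA.
    have [at0|at0] := eqVneq (a (tag t)) 0; last by rewrite mulrC divfK.
    by rewrite at0 mul0r; move/psumr_eq0P: at0 => -> //; rewrite eqxx.
  rewrite !ffunE (negPf tA) mulr0 add0r; case: ifP => [/eqP at1|at1]; last first.
    by rewrite mulrC divfK // subr_eq0 eq_sym at1.
  have := a1 (tag t); rewrite at1 subrr mul0r => /psumr_eq0P-> //.
  by rewrite eqxx.
have h0 i t : 0 <= h i t by case: i => [i|//] /=; rewrite ffunE; case: ifP.
rewrite xE; apply: conv_comb => [[i|]||i ci] //=.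
- by rewrite subr_ge0.
- by rewrite sumO /= subrK.
apply: conv_sections => [//|j|f fS hf].
  case: i ci => [i|//] /= ai; have [->|ji] := eqVneq j i.
    by rewrite -(z1 i ai); apply: eq_bigr => t; rewrite ffunE => ->.
  by rewrite -(y1 j); apply: eq_bigr => t /eqP tj; rewrite ffunE tj (negPf ji).
suff fA : fragment_vertex A f.
  exact: (conv_vertex (fun f : {f | fragment_vertex A f} => vertex (val f))
           (exist _ f fA)).
rewrite /fragment_vertex fS /=.
(* The point [h (Some j)] charges the complement of [A] in block [j] only, and
   [h None = y] does not charge it. *)
have badE l : f l \in cotuple A -> i = Some l.
  move=> lA; have := hf l; case: (i) => [l'|] /=; last by rewrite yA ?eqxx.
  rewrite ffunE (eqP (forallP fS l)); have [->|_] := eqVneq l l'; first by [].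
  by rewrite yA ?eqxx.
apply/card_le1_eqP => j j'; rewrite inE => /badE ij; rewrite inE => /badE.
by rewrite ij => -[->].
Qed.

End Vertices.

(** * Common minimizers along a chain *)

Section Chains.
Local Open Scope classical_set_scope.
Local Open Scope ring_scope.
Context {R : realType} {k : nat} (S : 'I_k -> finType).
Local Notation G := (ground S).
Local Notation V := (vec R G).
Implicit Types (A C : subtuple S) (w x y z : V).

(** Take an element of [B] in the smallest member of the chain that meets
    [B]. *)
Lemma chain_pick (T : finType) m (C : 'I_m -> {set T}) (B : {set T}) :
    B != finset.set0 -> (forall j j' : 'I_m, (j <= j')%N -> C j \subset C j') ->
  exists2 s, s \in B & forall j, (C j :&: B)%SET != finset.set0 -> s \in C j.
Proof.
move=> B0 Cmono.
pose meets j := (C j :&: B)%SET != finset.set0.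
case: (pickP meets) => [j0 j0B|nB].
  case: (@arg_minnP _ j0 meets (fun j => j : nat) j0B) => j /set0Pn[s].
  rewrite inE => /andP[sC sB] jmin; exists s => // j' /jmin jj'.
  exact: fintype.subsetP (Cmono _ _ jj') s sC.
by have /set0Pn[s sB] := B0; exists s => // j; rewrite -/(meets j) nB.
Qed.

(** The functionals of a chain attain their minima over the fragment at a common
    point, which is a vertex. *)
Lemma chain_minimizer A m (C : 'I_m -> subtuple S) :
    (forall i : 'I_k, (0 < #|S i|)%N) -> valid A -> (forall j, valid (C j)) ->
    (forall j j' : 'I_m, (j < j')%N -> tproper (C j) (C j')) ->
  exists2 z : V, fragment A z &
    forall j x, fragment A x -> dot (ufun (C j)) z <= dot (ufun (C j)) x.
Proof.
move=> S0 Av Cv Clt.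
have Cle i (j j' : 'I_m) : (j <= j')%N -> C j i \subset C j' i.
  rewrite leq_eqVlt => /orP[/eqP/val_inj->//|/Clt/andP[/forallP/(_ i)]].
  by [].
(* [o] is a block missed by every tuple of the chain that misses some block,
   found at the last such tuple; it is None if no tuple misses a block. *)
have [o oP] : exists o : option 'I_k, forall j i,
    (C j i :&: A i == finset.set0)%SET ->
    exists2 i0, o = Some i0 & (C j i0 :&: A i0 == finset.set0)%SET.
  pose misses (ji : 'I_m * 'I_k) :=
    (C ji.1 ji.2 :&: A ji.2 == finset.set0)%SET.
  case: (pickP misses) => [ji0 ji0P|nP].
    case: (@arg_maxnP _ ji0 misses (fun ji => ji.1 : nat) ji0P).
    move=> -[j0 i0] /= i0P jmax; exists (Some i0) => j i jiP; exists i0 => //.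
    rewrite -finset.subset0 -(eqP i0P); apply: finset.setSI; apply: Cle.
    exact: jmax (j, i) jiP.
  by exists None => j i; rewrite -/(misses (j, i)) nP.
have ai i : {s : S i | s \in A i /\
    forall j, (C j i :&: A i)%SET != finset.set0 -> s \in C j i}.
  by apply: cid; have [s] := chain_pick (Av i) (Cle i); exists s.
pose a i := sval (ai i).
have aP i : a i \in A i /\
    forall j, (C j i :&: A i)%SET != finset.set0 -> a i \in C j i := svalP (ai i).
have bi i : {s : S i | forall j, s \in C j i}.
  apply: cid; have T0 : [set: S i]%SET != finset.set0.
    by rewrite -card_gt0 cardsT S0.
  have [s _ sP] := chain_pick T0 (Cle i); exists s => j; apply: sP.
  by rewrite finset.setIT; apply: Cv.
pose b i := sval (bi i).
have bP i j : b i \in C j i := svalP (bi i) j.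
pose f : {ffun 'I_k -> G} :=
  [ffun i => Tagged S (if o == Some i then b i else a i)].
have fS : is_section f by apply/forallP => i; rewrite ffunE.
have fin D i : (f i \in cotuple D) =
    ((if o == Some i then b i else a i) \notin D i) by rewrite inE ffunE.
exists (vertex f).
  apply: fragment_vertexP; rewrite /fragment_vertex fS /=.
  have fA i : f i \in cotuple A -> o = Some i.
    by rewrite fin; case: eqP => // _; rewrite (aP i).1.
  apply/card_le1_eqP => i i'; rewrite inE => /fA oi; rewrite inE => /fA.
  by rewrite oi => -[->].
move=> j x /fragmentP[x0 x1 xA]; rewrite dot_ufun_vertex //.
set D := [set _ | _]%SET.
pose B := [set i | (C j i :&: A i == finset.set0)%SET]%SET.
(* The vertex stays in [C j] in block [o], and leaves it elsewhere only where
   [C j] misses [A]. *)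
have DB i : i \in D -> i \in B /\ o != Some i.
  rewrite !inE ffunE /=; case: eqP => [_|_ aC]; first by rewrite bP.
  split=> //; apply: contraR aC; exact: (aP i).2.
have [D0|/set0Pn[i /DB[iB _]]] := eqVneq D finset.set0.
  by rewrite D0 cards0 dot_ufun sumr_ge0.
have [i0 oi0 i0B] : exists2 i0, o = Some i0 & i0 \in B.
  have [|i0 -> i0P] := oP j i; first by move: iB; rewrite inE.
  by exists i0 => //; rewrite inE.
have DltB : (#|D| < #|B|)%N.
  apply: proper_card; apply/properP; split; first by apply/fintype.subsetP=> l /DB[].
  by exists i0 => //; apply/negP => /DB[_]; rewrite oi0 eqxx.
(* A block missed by [C j] has all its mass outside [C j] or outside [A]. *)
have leB : #|B|%:R <= dot (ufun (C j)) x + dot (ufun A) x.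
  rewrite -dotDl /dot sum_ground -sum1_card natr_sum big_mkcond.
  apply: ler_sum => l _; case: ifPn => [|_]; last first.
    by apply: sumr_ge0 => t _; rewrite mulr_ge0 // ffunE !ufunE addr_ge0.
  rewrite inE => lB; rewrite -(x1 l); apply: ler_sum => -[l' s] /= /eqP ll'.
  case: l / ll' lB => lB; rewrite ler_peMl // ffunE !ufunE !inE /= -natrD ler1n.
  have : s \notin (C j l' :&: A l')%SET by rewrite (eqP lB) inE.
  by rewrite inE negb_and; do 2![case: (_ \in _)].
rewrite -(lerD2r 1) natr1.
apply: le_trans (le_trans leB _); first by rewrite ler_nat.
by rewrite lerD2l dot_ufun.
Qed.

(** * The cone of the subdivision around a vector *)

(** A nonnegative vector vanishing somewhere in each block is a positive
    combination of the functionals of its proper sublevel sets. The last clause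
    says that these contain the zero set of [w]; it keeps the chain strict in
    the induction, which subtracts the smallest positive value of [w] from
    all of its nonzero coordinates. *)
Lemma chain_decomposition w :
    (forall t, 0 <= w t) -> (forall i, exists s : S i, w (Tagged S s) = 0) ->
  exists m (C : 'I_m -> subtuple S) (c : 'I_m -> R),
  [/\ forall j, 0 < c j, forall j, valid (C j) /\ C j != full S,
      forall j j' : 'I_m, (j < j')%N -> tproper (C j) (C j'),
      w = \sum_j c j *: ufun (C j)
    & forall j t, w t = 0 -> tagged t \in C j (tag t)].
Proof.
have [n] := ubnP #|[set t | w t != 0]%SET|.
elim: n => // n IHn in w *; rewrite ltnS => wn w0 wz.
pose supp t := w t != 0.
case: (pickP supp) => [t0 wt0|w_eq0]; last first.
  exists 0%N, (fun=> full S), (fun=> 0); split; try by case.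
  rewrite big_ord0; apply/ffunP => t; rewrite ffunE; apply/eqP.
  exact: negbFE (w_eq0 t).
case: (@arg_minP _ _ _ t0 supp w wt0) => t1; rewrite /supp => wt1 t1min.
pose Z : subtuple S := [ffun i => [set s | w (Tagged S s) == 0]%SET].
have ZE t : (tagged t \in Z (tag t)) = (w t == 0) by rewrite ffunE inE; case: t.
have uZ t : ufun Z t = (w t != 0)%:R :> R by rewrite ufunE inE ZE.
pose w' : V := w - w t1 *: ufun Z.
have w'E t : w' t = if w t == 0 then 0 else w t - w t1.
  rewrite sub_vecE scale_vecE uZ; case: eqP => [->|_] /=.
    by rewrite mulr0 subrr.
  by rewrite mulr1.
have w'0 t : w t = 0 -> w' t = 0 by rewrite w'E => ->; rewrite eqxx.
have w't1 : w' t1 = 0 by rewrite w'E (negPf wt1) subrr.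
have [||i|m [C [c [c0 Cv Clt w'c CZ]]]] := IHn w'.
- apply: leq_trans wn; apply: proper_card; apply/properP; split.
    apply/fintype.subsetP => t; rewrite !inE; apply: contra => /eqP/w'0->.
    by rewrite eqxx.
  by exists t1; rewrite inE // w't1 eqxx.
- by move=> t; rewrite w'E; case: ifPn => // wt; rewrite subr_ge0 t1min.
- by have [s ws] := wz i; exists s; apply: w'0.
have ZC j : tproper Z (C j).
  apply/andP; split.
    apply/forallP => i; apply/fintype.subsetP => s; rewrite ffunE inE => /eqP ws.
    exact: (CZ j (Tagged S s)) (w'0 _ ws).
  by apply: contraNneq wt1 => ZCj; rewrite -ZE ZCj CZ.
exists m.+1, (fun j => oapp C Z (unlift ord0 j)),
  (fun j => oapp c (w t1) (unlift ord0 j)); split.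
- move=> j; case: (unliftP ord0 j) => [j' _|_] /=; first exact: c0.
  by rewrite lt_neqAle eq_sym wt1 w0.
- move=> j; case: (unliftP ord0 j) => [j' _|_] /=; first exact: Cv.
  split=> [i|].
    by have [s ws] := wz i; apply/set0Pn; exists s; rewrite ffunE inE ws.
  by apply: contraNneq wt1 => Zf; rewrite -ZE Zf ffunE inE.
- move=> j j'; case: (unliftP ord0 j') => [l' ->|->] //=.
  by case: (unliftP ord0 j) => [l ->|->] //= ll'; apply: Clt.
- rewrite big_ord_recl unlift_none /=; under eq_bigr do rewrite liftK /=.
  by rewrite -w'c addrC subrK.
- move=> j t wt; case: (unliftP ord0 j) => [j' _|_] /=; first exact: CZ (w'0 t wt).
  by rewrite ZE wt.
Qed.

Lemma dot_lineality_fragment A x z u : fragment A x -> fragment A z ->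
  u \in lineality S -> dot u x = dot u z.
Proof.
move=> /fragmentP[_ x1 _] /fragmentP[_ z1 _] uL.
have eblockE i y : dot (eblock S i) y = \sum_(t | tag t == i) y t.
  rewrite -sum_block /eblock.
  under eq_bigr do rewrite -[evec _]scale1r.
  rewrite dot_combl; apply: eq_bigr => s _; rewrite mul1r /dot.
  rewrite (bigD1 (Tagged S s)) //= ffunE eqxx mul1r big1 ?addr0 // => t.
  by rewrite ffunE => /negPf->; rewrite mul0r.
have -> := @coord_span _ _ _ (in_tuple [seq eblock S i | i <- enum 'I_k]) _ uL.
rewrite !dot_combl; apply: eq_bigr => j _; congr (_ * _).
have /mapP[i _ ->] : [seq eblock (R := R) S i | i <- enum 'I_k]`_j \in
    [seq eblock S i | i <- enum 'I_k] by apply: mem_nth.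
by rewrite !eblockE x1 z1.
Qed.

Lemma block_constant_lineality (l : 'I_k -> R) :
  ([ffun t => l (tag t)] : V) \in lineality S.
Proof.
have -> : ([ffun t => l (tag t)] : V) = \sum_i l i *: eblock S i.
  apply/ffunP => t; rewrite ffunE comb_vecE (bigD1 (tag t)) //=.
  have eE i : eblock S i t = (tag t == i)%:R :> R.
    rewrite /eblock sum_ffunE.
    under eq_bigr do rewrite ffunE.
    rewrite (sum_block i (fun s => (t == s)%:R : R)) big_mkcond (bigD1 t) //= eqxx.
    rewrite big1 => [|s /negPf st]; last by rewrite [t == s]eq_sym st; case: ifP.
    by rewrite addr0; case: ifP.
  rewrite eE eqxx mulr1 big1 ?addr0 // => i it.
  by rewrite eE eq_sym (negPf it) mulr0.
apply: memv_suml => i _; apply: memvZ; apply: memv_span.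
by apply: map_f; rewrite mem_enum.
Qed.

(** * The normal fan of the fragment *)

Lemma fragment_coarsens A : (forall i : 'I_k, (0 < #|S i|)%N) -> valid A ->
  coarsens (normal_fan (fragment (R := R) A)) (bary_fan (S := S)).
Proof.
move=> S0 Av N [F [[xF xFF] [v Fv]] NF].
have FA x : F x -> fragment A x by rewrite Fv => -[].
exists [set D | bary_fan D /\ D `<=` N]; first by move=> D [].
apply/seteqP; split; last by move=> w [D [_ +]]; apply.
move=> w wN.
(* Subtracting the block minima [y] makes [w] vanish somewhere in each block. *)
have bi i : {s : S i | forall s' : S i, w (Tagged S s) <= w (Tagged S s')}.
  apply: cid; have /card_gt0P[s0 _] := S0 i.
  case: (@arg_minP _ _ _ s0 xpredT (fun s => w (Tagged S s)) isT) => s _ smin.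
  by exists s => s'; apply: smin.
pose b i := sval (bi i).
pose l i := w (Tagged S (b i)).
have bP t : l (tag t) <= w t by case: t => i s; apply: svalP (bi i) s.
pose y : V := [ffun t => l (tag t)].
have [t|i|m [C [c [c0 Cv Clt wc _]]]] := @chain_decomposition (w - y).
- by rewrite !ffunE subr_ge0; apply: bP.
- by exists (b i); rewrite !ffunE subrr.
have [|z zA zmin] := @chain_minimizer A m C S0 Av _ Clt.
  by move=> j; case: (Cv j).
have wE : w = \sum_j c j *: ufun (C j) + y by rewrite -wc subrK.
exists (chain_cone C); last first.
  exists (\sum_j c j *: ufun (C j)); last exists y => //=.
    by exists c; split=> // j; apply: ltW.
  exact: block_constant_lineality.
split; first by exists m, C.
move=> _ [_ [d [d0 ->]] [y' y'L <-]]; rewrite -NF => x xF' x' xA'.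
have xA := FA x xF'.
(* [x] minimizes [w], so the nonnegative terms [c j * (u_C x - u_C z)] have a
   nonpositive sum; since [c j > 0], every [u_C] takes the same value at [x]
   and at [z]. *)
have ux j : dot (ufun (C j)) x = dot (ufun (C j)) z.
  have /psumr_eq0P c_eq0 : forall j, true ->
      0 <= c j * (dot (ufun (C j)) x - dot (ufun (C j)) z).
    by move=> i _; rewrite mulr_ge0 ?subr_ge0 ?zmin // ltW.
  apply/eqP; rewrite -subr_eq0 -(mulrI_eq0 _ (lregP (lt0r_neq0 (c0 j)))).
  apply/eqP; apply: c_eq0 => //; apply/eqP; rewrite eq_le; apply/andP; split.
    have := wN; rewrite -NF => /(_ x xF' z zA).
    rewrite wE !dotDl !dot_combl (dot_lineality_fragment xA zA); last first.
      exact: block_constant_lineality.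
    rewrite lerD2r -subr_le0 -sumrB.
    by under eq_bigr do rewrite -mulrBr.
  by apply: sumr_ge0 => i _; rewrite mulr_ge0 ?subr_ge0 ?zmin // ltW.
rewrite !dotDl !dot_combl (dot_lineality_fragment xA xA' y'L) lerD2r.
by apply: ler_sum => j _; rewrite ux ler_wpM2l // zmin.
Qed.

End Chains.

Theorem proposition6p32 (R : realType) (k : nat) (S : 'I_k -> finType)
    (k_ge1 : (1 <= k)%N) (S_neq0 : forall i : 'I_k, (0 < #|S i|)%N)
    (A : subtuple S) (A_valid : valid A) (A_proper : A != full S) :
  omnitruncation_deformation (fragment (R := R) A).
Proof.
split; last exact: fragment_coarsens.
by rewrite fragment_conv //; apply: polytope_conv.
Qed.
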